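(* Let $\beta>1$ and $p>0$, and let $\beta'$ be the exponent conjugate to $\beta$. Let $\lambda=\{\lambda_k\}_{k\ge0}$ be a sequence such that $\lambda_k\in(0,1]$ for all $k$ and $\lambda_k<1$ for at most finitely many $k$. For $h>0$ define $$\mu_d(h)=\inf\Big\{\sum_{k=0}^\infty|a_k|^pe^{\beta'k}:\ \|a\|_1=h,\ \|\lambda a\|_{\beta'}\le1\Big\},$$ the infimum being over real sequences $a=\{a_k\}_{k\ge0}$. Then for each $h_0>0$ there exist positive constants $C=C(p,\beta,h_0)$ and $C'=C'(p,\beta,h_0)$ such that $$Ce^{-L_\lambda\beta'}\,\frac{\exp[\beta'h^\beta]}{h^{p\beta/\beta'}}\le\mu_d(h)\le C'\,\frac{\exp[\beta'h^\beta]}{h^{p\beta/\beta'}}\qquad\text{for all }h\ge h_0,$$ where $$L_\lambda=\sum_{k=0}^\infty\big(\lceil\lambda_k^{-\beta}\rceil-1\big).$$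
   Context: For a sequence $a=\{a_k\}_{k\ge0}$, $\|a\|_q=\big(\sum_{k=0}^\infty|a_k|^q\big)^{1/q}$, and $\lambda a=\{\lambda_ka_k\}_{k\ge0}$. The conjugate exponent satisfies $\frac1\beta+\frac1{\beta'}=1$. The constants $C,C'$ depend only on $p,\beta,h_0$ (not on $\lambda$). *)

(* Defs.v *)
From HB Require Import structures.
From mathcomp Require Import all_boot all_order all_algebra.
From mathcomp Require Import all_classical all_reals all_analysis.

Set Implicit Arguments.
Unset Strict Implicit.
Unset Printing Implicit Defensive.
Import Order.TTheory GRing.Theory Num.Theory.
Import numFieldNormedType.Exports.

Local Open Scope classical_set_scope.
Local Open Scope ring_scope.

(* Values are in \bar R because the defining series may diverge: the norm of a
   sequence outside l^q is +oo. *)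
Definition lnorm (R : realType) (q : R) (a : R^nat) : \bar R :=
  'N[@counting nat R]_(q%:E)[EFin \o a]%E.

Lemma lnormE (R : realType) (q : R) (a : R^nat) : 0 < q ->
  lnorm q a = ((\sum_(k <oo) (`|a k| `^ q)%:E) `^ q^-1)%E.
Proof. by move=> q0; rewrite /lnorm Lnorm_counting. Qed.

Definition mu_d (R : realType) (p beta' : R) (lambda : R^nat) (h : R) :
    \bar R :=
  ereal_inf [set (\sum_(k <oo) (`|a k| `^ p * expR (beta' * k%:R))%:E)%E
    | a in [set a : R^nat | lnorm 1 a = h%:E /\
                            (lnorm beta' (fun k => lambda k * a k)%R <= 1)%E]].

(* The limit of partial sums in R; it is used only when all but finitely many
   terms vanish, hence when the series converges. *)
Definition Lsum (R : realType) (beta : R) (lambda : R^nat) : R :=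
  limn (series (fun k => (Num.ceil (lambda k `^ (- beta)) - 1)%:~R : R)).

(* Main.v *)
(* Upper bound: spread the mass h evenly over the first N ~ h^beta indices.
   Lower bound: Young's inequality with weights lambda_k^-1 bounds the mass of a
   feasible a on the first n indices by K as soon as
   sum_(k < n) lambda_k^-beta <= n + L_lambda <= K^beta. With K^beta >= h^beta - 1
   and n ~ h^beta - 1 - L_lambda, Bernoulli's inequality leaves at least
   h - K = h^(1-beta) / beta to the tail k >= n. If the functional has value x,
   then a_k <= x^(1/p) e^(-beta' k / p) for every k, so that tail mass is at most
   a constant times x^(1/p) e^(-beta' n / p), which bounds x from below. *)

Require Import Defs.
From HB Require Import structures.
From mathcomp Require Import all_boot all_order all_algebra.
From mathcomp Require Import all_classical all_reals all_analysis.
From mathcomp Require Import ring lra.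
Import Order.TTheory GRing.Theory Num.Theory.
Import numFieldNormedType.Exports.
Local Open Scope classical_set_scope.
Local Open Scope ring_scope.

Lemma conjugate_gt1 (R : realFieldType) (b q : R) :
  1 < b -> b^-1 + q^-1 = 1 -> 1 < q.
Proof.
move=> b1 bq; have b0 : 0 < b by rewrite (lt_trans ltr01).
have qE : q^-1 = 1 - b^-1 by rewrite -bq addrC addKr.
have q0 : 0 < q by rewrite -invr_gt0 qE subr_gt0 invf_lt1.
by rewrite -invf_lt1 // qE ltrBlDr ltrDl invr_gt0.
Qed.

Lemma sum_geometric_le (R : realFieldType) (r : R) (m n : nat) :
  0 <= r -> r < 1 -> \sum_(m <= k < n) r ^+ k <= r ^+ m / (1 - r).
Proof.
move=> r0 r1; have [mn|nm] := leqP m n; last first.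
  by rewrite big_geq 1?ltnW // divr_ge0 ?exprn_ge0 // subr_ge0 ltW.
rewrite ler_pdivlMr ?subr_gt0 // mulr_suml.
under eq_bigr do rewrite mulrBr mulr1 -exprSr -opprB.
by rewrite sumrN telescope_sumr // opprB gerBl exprn_ge0.
Qed.

Lemma powR_ge_tangent1 (R : realType) (b y : R) :
  1 < b -> 0 <= y -> 1 + b * (y - 1) <= y `^ b.
Proof.
move=> b1 y0; have b0 : 0 < b by rewrite (lt_trans ltr01).
have bN0 : b != 0 by rewrite gt_eqF.
have b1N0 : b - 1 != 0 by rewrite gt_eqF // subr_gt0.
have c0 : 0 < b / (b - 1) by rewrite divr_gt0 // subr_gt0.
have bc : b^-1 + (b / (b - 1))^-1 = 1 by field; rewrite bN0 b1N0.
have := conjugate_powR y0 ler01 b0 c0 bc; rewrite powR1 mulr1.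
rewrite -(ler_pM2l b0) mulrDr mulrCA divff // mulr1 => H.
have -> : 1 + b * (y - 1) = b * y - b * (1 / (b / (b - 1))) by field; rewrite bN0 b1N0.
by rewrite lerBlDr.
Qed.

Lemma sum_le_of_weighted_norm_le1 (R : realType) (b q K : R) (lambda a : R^nat)
    (n : nat) :
  0 < b -> 0 < q -> b^-1 + q^-1 = 1 -> 0 < K ->
  (forall k, 0 < lambda k) -> (forall k, 0 <= a k) ->
  \sum_(0 <= k < n) lambda k `^ (- b) <= K `^ b ->
  \sum_(0 <= k < n) (lambda k * a k) `^ q <= 1 ->
  \sum_(0 <= k < n) a k <= K.
Proof.
move=> b0 q0 bq K0 l0 a0 lK la1.
suff : \sum_(0 <= k < n) (a k / K) <= 1.
  by rewrite -mulr_suml ler_pdivrMr // mul1r.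
rewrite -bq -[X in X + _]mul1r -[X in _ + X]mul1r.
apply: (@le_trans _ _ (\sum_(0 <= k < n)
   (lambda k `^ (- b) / K `^ b / b + (lambda k * a k) `^ q / q))).
  apply: ler_sum => k _.
  have -> : a k / K = ((lambda k)^-1 / K) * (lambda k * a k).
    by field; rewrite !gt_eqF.
  apply: le_trans (conjugate_powR _ _ b0 q0 bq) _.
  - by rewrite divr_ge0 ?invr_ge0 ?ltW.
  - by rewrite mulr_ge0 ?(ltW (l0 k)).
  have invX y : 0 < y -> y^-1 `^ b = y `^ (- b).
    by move=> y0; rewrite -powR_inv1 ?ltW // -powRrM mulN1r.
  have -> : ((lambda k)^-1 / K) `^ b = lambda k `^ (- b) / K `^ b.
    by rewrite powRM ?invr_ge0 ?(ltW (l0 k)) ?(ltW K0) // !invX // [K `^ _]powRN.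
  by [].
rewrite big_split /= -!mulr_suml lerD // ler_pM2r ?invr_gt0 //.
by rewrite ler_pdivrMr ?powR_gt0 // mul1r.
Qed.

Lemma tail_sum_le (R : realType) (p q x : R) (a : R^nat) (m n : nat) :
  0 < p -> 0 < q -> (forall k, 0 <= a k) ->
  (forall k, a k `^ p * expR (q * k%:R) <= x) ->
  \sum_(m <= k < n) a k <=
    x `^ p^-1 * expR (- (q / p) * m%:R) / (1 - expR (- (q / p))).
Proof.
move=> p0 q0 a0 ax; set r := expR (- (q / p)).
have r0 : 0 <= r by rewrite expR_ge0.
have r1 : r < 1 by rewrite expR_lt1 oppr_lt0 divr_gt0.
have rE k : r ^+ k = expR (- (q / p) * k%:R).
  by rewrite -powR_mulrn // expRM.
rewrite -mulrA -rE.
apply: (@le_trans _ _ (x `^ p^-1 * \sum_(m <= k < n) r ^+ k)); last first.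
  by rewrite ler_wpM2l ?powR_ge0 ?sum_geometric_le.
rewrite mulr_sumr; apply: ler_sum => k _.
rewrite rE mulNr expRN ler_pdivlMr ?expR_gt0 //.
have -> : a k * expR (q / p * k%:R) = (a k `^ p * expR (q * k%:R)) `^ p^-1.
  rewrite powRM ?powR_ge0 ?expR_ge0 // -powRrM divff ?gt_eqF // powRr1 //.
  by rewrite -expRM mulrAC.
have t0 : 0 <= a k `^ p * expR (q * k%:R) by rewrite mulr_ge0 ?powR_ge0 ?expR_ge0.
by apply: ge0_ler_powR; rewrite ?nnegrE ?invr_ge0 ?(ltW p0) ?(le_trans t0 (ax k)).
Qed.

Lemma weighted_sum_ge_tail (R : realType) (p q x h K : R) (a : R^nat)
    (n : nat) :
  0 < p -> 0 < q -> (forall k, 0 <= a k) ->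
  (forall k, a k `^ p * expR (q * k%:R) <= x) ->
  (\sum_(0 <= k <oo) (a k)%:E = h%:E)%E ->
  \sum_(0 <= k < n) a k <= K -> K <= h ->
  (1 - expR (- (q / p))) `^ p * (h - K) `^ p * expR (q * n%:R) <= x.
Proof.
move=> p0 q0 a0 ax ah aK Kh.
have x0 : 0 <= x by apply: le_trans (ax 0%N); rewrite mulr_ge0 ?powR_ge0 ?expR_ge0.
have D0 : 0 < 1 - expR (- (q / p)).
  by rewrite subr_gt0 expR_lt1 oppr_lt0 divr_gt0.
set B := x `^ p^-1 * expR (- (q / p) * n%:R) / (1 - expR (- (q / p))).
have hB : h - K <= B.
  rewrite lerBlDl -lee_fin -ah; apply: lime_le.
    by apply: is_cvg_nneseries => k _ _; rewrite lee_fin.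
  exists n => // m /= nm; rewrite sumEFin lee_fin (big_cat_nat (leq0n n) nm) //=.
  by rewrite lerD // tail_sum_le.
have : (1 - expR (- (q / p))) * (h - K) * expR (q / p * n%:R) <= x `^ p^-1.
  rewrite -ler_pdivlMr ?expR_gt0 // -expRN -(mulNr (q / p)) mulrC -ler_pdivlMr //.
move=> /(ge0_ler_powR (ltW p0)).
rewrite !nnegrE !mulr_ge0 ?powR_ge0 ?expR_ge0 ?(ltW D0) ?subr_ge0 //.
move=> /(_ isT isT).
rewrite !powRM ?mulr_ge0 ?powR_ge0 ?expR_ge0 ?(ltW D0) ?subr_ge0 //.
rewrite -powRrM mulVf ?gt_eqF // powRr1 // -expRM.
by have -> : q / p * n%:R * p = q * n%:R by field; rewrite gt_eqF.
Qed.

Lemma sum_weights_le_Lsum (R : realType) (b : R) (lambda : R^nat) (n : nat) :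
  0 < b -> (forall k, 0 < lambda k <= 1) ->
  finite_set [set k | lambda k < 1] ->
  \sum_(0 <= k < n) lambda k `^ (- b) <= n%:R + Lsum b lambda.
Proof.
move=> b0 l01 /finite_seqP[s sE].
set u := fun k => (Num.ceil (lambda k `^ (- b)) - 1)%:~R : R.
have u0 k : 0 <= u k.
  have /andP[l0 l1] := l01 k.
  rewrite ler0z subr_ge0 -gtz0_ge1 ceil_gt0 powR_gt0 //.
have ndu : {homo series u : i j / (i <= j)%N >-> i <= j}.
  by apply/nondecreasing_seqP => i; rewrite /series /= big_nat_recr //= lerDl.
have cu : cvgn (series u).
  set M := (\max_(i <- s) i).+1.
  apply: (@is_cvg_near_cst _ _ (series u M)).
  exists M => // m /= Mm.
  rewrite /series /= (big_cat_nat (leq0n M) Mm) //= [X in _ + X]big_nat [X in _ + X]big1 ?addr0 //.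
  move=> k /andP[Mk _].
  have /andP[l0 l1] := l01 k.
  suff lk1 : lambda k = 1 by rewrite /u lk1 powR1 ceil1 subrr.
  apply/eqP; rewrite eq_le l1 leNgt; apply/negP => lk.
  have : [set` s] k by rewrite -sE.
  move=> /= ks; have := @leq_bigmax_seq _ s xpredT id k ks isT.
  by rewrite leqNgt Mk.
rewrite -lerBlDl.
apply: (le_trans _ (nondecreasing_cvgn_le ndu cu n)).
have -> : n%:R = \sum_(0 <= k < n) (1 : R) by rewrite big_const_nat subn0 iter_addr_0.
rewrite -sumrB /series /=; apply: ler_sum => k _.
by rewrite /u intrB lerB // ceil_ge.
Qed.

Lemma eseries_EFin_finite (R : realType) (u : R^nat) (N : nat) :
  (forall k, 0 <= u k) -> (forall k, (N <= k)%N -> u k = 0) ->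
  (\sum_(0 <= k <oo) (u k)%:E = (\sum_(0 <= k < N) u k)%:E)%E.
Proof.
move=> u0 uN; rewrite (nneseries_split 0 N) ?add0n; last first.
  by move=> k _; rewrite lee_fin.
by rewrite eseries0 ?adde0 ?sumEFin // => k Nk _; rewrite uN.
Qed.

Lemma lnorm1E (R : realType) (a : R^nat) :
  (lnorm 1 a = \sum_(0 <= k <oo) `|a k|%:E)%E.
Proof.
rewrite lnormE // invr1 poweRe1; last first.
  by apply: nneseries_ge0 => k _ _; rewrite lee_fin powR_ge0.
by apply: eq_eseriesr => k _; rewrite powRr1.
Qed.

Lemma lnorm_le1 (R : realType) (q : R) (a : R^nat) : 0 < q ->
  (lnorm q a <= 1)%E = (\sum_(0 <= k <oo) (`|a k| `^ q)%:E <= 1)%E.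
Proof.
move=> q0; rewrite lnormE //; set S := (limn _)%E.
have S0 : (0 <= S)%E by apply: nneseries_ge0 => k _ _; rewrite lee_fin powR_ge0.
have mono r (x y : \bar R) : 0 < r -> (0 <= x)%E -> (0 <= y)%E -> (x <= y)%E ->
    (x `^ r <= y `^ r)%E.
  by move=> r0 x0 y0; apply: gt0_ler_poweR; rewrite ?(ltW r0) // in_itv /= ?x0 ?y0 leey.
apply/idP/idP => [|S1].
  move=> /(mono q _ _ q0 (poweR_ge0 _ _) lee01).
  by rewrite -poweRrM mulVf ?gt_eqF // poweRe1 // poweR1r.
by have := mono q^-1 _ _ _ S0 lee01 S1; rewrite poweR1r invr_gt0; apply.
Qed.

Lemma powR_cofactor (R : realType) (b h p : R) : 0 < h ->
  (h / h `^ b) `^ p = (h `^ (p * (b - 1)))^-1.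
Proof.
move=> h0; have hN0 : h != 0 by rewrite gt_eqF.
rewrite -[X in X / _]powRr1 ?(ltW h0) // -powRB ?hN0 ?implybT //.
by rewrite -powRrM -powRN; congr (_ `^ _); ring.
Qed.

Lemma weighted_sum_ge (R : realType) (b q p hmin L h x : R) (lambda a : R^nat) :
  1 < b -> b^-1 + q^-1 = 1 -> 0 < p -> 0 < hmin -> hmin <= h ->
  (forall k, 0 < lambda k) -> (forall k, 0 <= a k) ->
  (forall n, \sum_(0 <= k < n) lambda k `^ (- b) <= n%:R + L) ->
  (forall n, \sum_(0 <= k < n) (lambda k * a k) `^ q <= 1) ->
  (forall k, a k `^ p * expR (q * k%:R) <= x) ->
  (\sum_(0 <= k <oo) (a k)%:E = h%:E)%E ->
  (1 - expR (- (q / p))) `^ p *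
    Num.min (b^-1 `^ p * expR (- (2 * q))) (expR (- q) * hmin `^ (p * b)) *
    expR (- (L * q)) * (expR (q * h `^ b) / h `^ (p * (b - 1))) <= x.
Proof.
move=> b1 bq p0 h00 h0h l0 a0 lL la1 ax ah.
have b0 : 0 < b by rewrite (lt_trans ltr01).
have h0 : 0 < h by rewrite (lt_le_trans h00).
have hN0 : h != 0 by rewrite gt_eqF.
have q0 : 0 < q := lt_trans ltr01 (conjugate_gt1 _ b q b1 bq).
have L0 : 0 <= L by have := lL 0%N; rewrite big_geq // add0r.
set D := (_ `^ p); have D0 : 0 <= D by rewrite powR_ge0.
have H0 : 0 < h `^ (p * (b - 1)) by rewrite powR_gt0.
set m := Num.min _ _.
have [hL|hL] := leP (1 + L) (h `^ b); last first.
  have := @weighted_sum_ge_tail R p q x h 0 a 0%N p0 q0 a0 ax ah.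
  rewrite big_geq // lexx (ltW h0) subr0 mulr0 expR0 mulr1 => /(_ isT isT).
  apply: le_trans; rewrite -!mulrA ler_wpM2l // !mulrA ler_pdivrMr //.
  rewrite -powRD ?hN0 ?implybT //.
  have -> : p + p * (b - 1) = p * b by ring.
  rewrite -mulrA -expRD.
  apply: (@le_trans _ _ (expR (- q) * hmin `^ (p * b) * expR q)).
    apply: ler_pM.
    - by rewrite /m le_min !mulr_ge0 ?powR_ge0 ?expR_ge0.
    - by rewrite expR_ge0.
    - by rewrite /m ge_min lexx orbT.
    - by rewrite ler_expR; nra.
  rewrite mulrAC -expRD addNr expR0 mul1r.
  by apply: ge0_ler_powR;
    rewrite ?nnegrE ?mulr_ge0 ?(ltW p0) ?(ltW b0) ?(ltW h0) ?(ltW h00).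
set n := Num.trunc (h `^ b - L - 1).
have /andP[n1 n2] : n%:R <= h `^ b - L - 1 < n.+1%:R.
  by apply: truncn_itv; lra.
have hb1 : 1 <= h `^ b by lra.
have hb0 : 0 < h `^ b by lra.
set y := 1 - (h `^ b)^-1 / b.
have y0 : 0 < y.
  rewrite subr_gt0 -invfM invf_lt1 ?mulr_gt0 //.
  by rewrite (lt_le_trans b1) // ler_peMl // ltW.
have hK : h - h * y = h / h `^ b * b^-1 by rewrite /y; field; rewrite !gt_eqF.
have := @weighted_sum_ge_tail R p q x h (h * y) a n p0 q0 a0 ax ah.
have -> : \sum_(0 <= k < n) a k <= h * y.
  apply: (sum_le_of_weighted_norm_le1 _ _ _ _ lambda _ _ b0 q0 bq _ l0 a0 _ (la1 n)).
    by rewrite mulr_gt0.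
  apply: (le_trans (lL n)).
  rewrite powRM ?(ltW h0) ?(ltW y0) //.
  apply: (@le_trans _ _ (h `^ b * (1 + b * (y - 1)))).
    have -> : h `^ b * (1 + b * (y - 1)) = h `^ b - 1.
      by rewrite /y; field; rewrite !gt_eqF.
    lra.
  by rewrite ler_wpM2l ?powR_ge0 // powR_ge_tangent1 // ltW.
have -> : h * y <= h.
  by rewrite -subr_ge0 hK mulr_ge0 ?divr_ge0 ?invr_ge0 ?powR_ge0 ?ltW.
move=> /(_ isT isT); apply: le_trans.
rewrite hK powRM ?invr_ge0 ?divr_ge0 ?powR_ge0 ?(ltW h0) ?(ltW b0) //.
rewrite powR_cofactor // -!mulrA ler_wpM2l //.
rewrite !mulrA [X in _ <= X * _]mulrC -!mulrA.
rewrite [X in _ <= _ * X]mulrC !mulrA ler_pM2r ?invr_gt0 //.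
rewrite -!mulrA -expRD.
apply: (@le_trans _ _ (b^-1 `^ p * expR (- (2 * q)) *
    expR (- (L * q) + q * h `^ b))).
  by rewrite ler_wpM2r ?expR_ge0 // /m ge_min lexx.
rewrite -mulrA -expRD ler_wpM2l ?powR_ge0 // ler_expR.
by move: n2; rewrite -natr1; nra.
Qed.

Lemma mu_d_le (R : realType) (b q p h : R) (lambda : R^nat) :
  1 < b -> b^-1 + q^-1 = 1 -> 0 < p -> 0 < h ->
  (forall k, 0 < lambda k <= 1) ->
  (mu_d p q lambda h <=
    (expR q / (expR q - 1) * (expR (q * h `^ b) / h `^ (p * (b - 1))))%:E)%E.
Proof.
move=> b1 bq p0 h0 l01.
have b0 : 0 < b by rewrite (lt_trans ltr01).
have q1 : 1 < q := conjugate_gt1 _ b q b1 bq.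
have q0 : 0 < q := lt_trans ltr01 q1.
have bq1 : b * (q - 1) = q.
  have : b * q * (b^-1 + q^-1) = b * q by rewrite bq mulr1.
  have -> : b * q * (b^-1 + q^-1) = q + b by field; rewrite !gt_eqF.
  by move=> E; rewrite mulrBr mulr1 -E addrK.
set N := (Num.trunc (h `^ b)).+1.
have /andP[N1 N2] : (Num.trunc (h `^ b))%:R <= h `^ b < N%:R.
  by apply: truncn_itv; rewrite powR_ge0.
have N0 : 0 < N%:R :> R by rewrite ltr0n.
pose a k : R := if (k < N)%N then h / N%:R else 0.
have hN0 : 0 <= h / N%:R by rewrite divr_ge0 ?ltW.
have a0 k : 0 <= a k by rewrite /a; case: ifP.
have aN k : (N <= k)%N -> a k = 0 by rewrite /a ltnNge => ->.
have sum_a (F : R -> nat -> R) :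
    \sum_(0 <= k < N) F (a k) k = \sum_(0 <= k < N) F (h / N%:R) k.
  by apply: eq_big_nat => k /andP[_ kN]; rewrite /a kN.
have sum_cst (c : R) : \sum_(0 <= k < N) c = c * N%:R.
  by rewrite big_const_nat subn0 iter_addr_0 mulr_natr.
have na k : `|a k| = a k by rewrite ger0_norm.
apply: (@le_trans _ _ (\sum_(0 <= k <oo) (`|a k| `^ p * expR (q * k%:R))%:E)%E).
  apply: ereal_inf_lbound; exists a => //=; split.
    rewrite lnorm1E (@eseries_EFin_finite _ (fun k => `|a k|) N).
    - under eq_bigr do rewrite na.
      by rewrite (sum_a (fun x _ => x)) sum_cst divfK ?gt_eqF.
    - by move=> k; rewrite normr_ge0.
    - by move=> k Nk; rewrite aN ?normr0.
  rewrite lnorm_le1 // (@eseries_EFin_finite _ (fun k => `|lambda k * a k| `^ q) N).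
  - rewrite lee_fin.
    apply: (@le_trans _ _ (\sum_(0 <= k < N) (a k) `^ q)).
      apply: ler_sum => k _; have /andP[l0 l1] := l01 k.
      rewrite ge0_ler_powR ?nnegrE ?(ltW q0) // normrM na (gtr0_norm l0).
      by rewrite ler_piMl.
    rewrite (sum_a (fun x _ => x `^ q)) sum_cst.
    rewrite -ler_pdivlMr // div1r.
    have hqN : h `^ q <= N%:R `^ (q - 1).
      rewrite -[X in h `^ X]bq1 powRrM; apply: ge0_ler_powR.
      - by rewrite subr_ge0 ltW.
      - by rewrite nnegrE powR_ge0.
      - by rewrite nnegrE ltW.
      - exact: ltW.
    rewrite powRM ?invr_ge0 ?(ltW h0) ?(ltW N0) //.
    rewrite -[X in _ * X `^ _]powR_inv1 ?(ltW N0) // -powRrM mulN1r powRN.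
    rewrite ler_pdivrMr ?powR_gt0 // -(mulr_powRB1 (ltW N0) q0).
    by rewrite mulrA mulVf ?gt_eqF // mul1r.
  - by move=> k; rewrite powR_ge0.
  - by move=> k Nk; rewrite aN // mulr0 normr0 powR0 // gt_eqF.
rewrite (@eseries_EFin_finite _ (fun k => `|a k| `^ p * expR (q * k%:R)) N); first last.
- by move=> k Nk; rewrite aN // normr0 powR0 ?gt_eqF // mul0r.
- by move=> k; rewrite mulr_ge0 ?powR_ge0 ?expR_ge0.
rewrite lee_fin.
under eq_bigr do rewrite na.
rewrite (sum_a (fun x k => x `^ p * expR (q * k%:R))) -mulr_sumr.
have eq1 : 0 < expR q - 1 by rewrite subr_gt0 expR_gt1.
have -> : \sum_(0 <= k < N) expR (q * k%:R) = (expR (q * N%:R) - 1) / (expR q - 1).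
  have eX k : expR (q * k%:R) = expR q ^+ k by rewrite expRM powR_mulrn ?expR_ge0.
  under eq_bigr do rewrite eX.
  by rewrite eX subrX1 big_mkord mulrAC divff ?mul1r // gt_eqF.
have hNp : (h / N%:R) `^ p <= (h `^ (p * (b - 1)))^-1.
  rewrite -powR_cofactor //; apply: ge0_ler_powR; rewrite ?(ltW p0) ?nnegrE //.
    by rewrite divr_ge0 ?powR_ge0 ?ltW.
  by rewrite ler_pM2l // lef_pV2 ?posrE ?powR_gt0 // ltW.
apply: (@le_trans _ _ ((h `^ (p * (b - 1)))^-1 *
    (expR q * expR (q * h `^ b) / (expR q - 1)))).
  apply: ler_pM; rewrite ?powR_ge0 //.
    rewrite divr_ge0 ?(ltW eq1) // subr_ge0 -expR0 ler_expR mulr_ge0 ?ler0n //.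
    exact: ltW.
  rewrite ler_pM2r ?invr_gt0 // -expRD (@le_trans _ _ (expR (q * N%:R))) //.
    by rewrite gerBl.
  by rewrite ler_expR /N -natr1; nra.
by rewrite le_eqVlt; apply/orP; left; apply/eqP; ring.
Qed.

Lemma mu_d_ge (R : realType) (b q p hmin h : R) (lambda : R^nat) :
  1 < b -> b^-1 + q^-1 = 1 -> 0 < p -> 0 < hmin -> hmin <= h ->
  (forall k, 0 < lambda k <= 1) -> finite_set [set k | lambda k < 1] ->
  (((1 - expR (- (q / p))) `^ p *
    Num.min (b^-1 `^ p * expR (- (2 * q))) (expR (- q) * hmin `^ (p * b)) *
    expR (- (Lsum b lambda * q)) *
    (expR (q * h `^ b) / h `^ (p * (b - 1))))%:E <= mu_d p q lambda h)%E.
Proof.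
move=> b1 bq p0 h00 h0h l01 lfin.
have b0 : 0 < b by rewrite (lt_trans ltr01).
have q0 : 0 < q := lt_trans ltr01 (conjugate_gt1 _ b q b1 bq).
apply: le_ereal_inf_tmp => _ [a [ah la1] <-].
have l0 k : 0 < lambda k by have /andP[] := l01 k.
set X := (\sum_(0 <= k <oo) _)%E.
have t0 k : 0 <= `|a k| `^ p * expR (q * k%:R).
  by rewrite mulr_ge0 ?powR_ge0 ?expR_ge0.
have X0 : (0 <= X)%E by apply: nneseries_ge0 => k _ _; rewrite lee_fin.
case XE : X X0 => [x| |] // X0; last by rewrite leey.
rewrite lee_fin.
apply: (@weighted_sum_ge _ _ _ _ _ _ _ _ lambda (fun k => `|a k|)) => //.
- by move=> n; exact: sum_weights_le_Lsum.
- move=> n; move: la1; rewrite lnorm_le1 // => la1.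
  rewrite -lee_fin -sumEFin; apply: (le_trans _ la1).
  under eq_bigr => k _ do rewrite -{1}(gtr0_norm (l0 k)) -normrM.
  by apply: nneseries_lim_ge => k _ _; rewrite lee_fin powR_ge0.
- move=> k; rewrite -lee_fin -XE.
  apply: (@le_trans _ _ (\sum_(0 <= i < k.+1) (`|a i| `^ p * expR (q * i%:R))%:E)%E).
    rewrite sumEFin lee_fin big_nat_recr //= lerDr.
    by apply: sumr_ge0.
  by apply: nneseries_lim_ge => i _ _; rewrite lee_fin.
- by rewrite -lnorm1E.
Qed.

Theorem lemma2 (R : realType) (beta beta' p : R)
    (hbeta : 1 < beta) (hbeta' : 1 / beta + 1 / beta' = 1) (hp : 0 < p) :
  forall h0 : R, 0 < h0 ->
  exists C C' : R, [/\ 0 < C, 0 < C' &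
    forall lambda : R^nat,
      (forall k, 0 < lambda k <= 1) ->
      finite_set [set k | lambda k < 1] ->
      forall h : R, h0 <= h ->
        ((C * expR (- (Lsum beta lambda * beta')) *
            (expR (beta' * h `^ beta) / h `^ (p * beta / beta')))%:E
          <= mu_d p beta' lambda h)%E /\
        (mu_d p beta' lambda h
          <= (C' * (expR (beta' * h `^ beta) / h `^ (p * beta / beta')))%:E)%E].
Proof.
move=> h0 h00.
have bq : beta^-1 + beta'^-1 = 1 by move: hbeta'; rewrite !div1r.
have b0 : 0 < beta by rewrite (lt_trans ltr01).
have q1E : beta'^-1 = 1 - beta^-1 by rewrite -bq addrC addKr.
have q0 : 0 < beta' := lt_trans ltr01 (conjugate_gt1 _ _ _ hbeta bq).
have -> : p * beta / beta' = p * (beta - 1).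
  by rewrite q1E; field; rewrite gt_eqF.
exists ((1 - expR (- (beta' / p))) `^ p *
  Num.min (beta^-1 `^ p * expR (- (2 * beta'))) (expR (- beta') * h0 `^ (p * beta))).
exists (expR beta' / (expR beta' - 1)); split.
- rewrite mulr_gt0 ?powR_gt0 ?subr_gt0 ?expR_lt1 ?oppr_lt0 ?divr_gt0 //.
  by rewrite lt_min !mulr_gt0 ?powR_gt0 ?expR_gt0 ?invr_gt0.
- by rewrite divr_gt0 ?expR_gt0 // subr_gt0 expR_gt1.
move=> lambda l01 lfin h h0h; split; first exact: mu_d_ge.
by apply: mu_d_le => //; exact: lt_le_trans h0h.
Qed.
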